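(* As formal power series in $x$, $$\sum_{n\ge 0}|\mathcal{M}_n(P_1,P_2)|\,x^n=\frac{(1-x)^3}{1-4x+5x^2-3x^3}.$$
   Context: A matching with $n$ arcs is a partition of $\{1,2,\ldots,2n\}$ into blocks of size 2, called arcs; an arc is written $[a,b]$ with $a<b$, where $a$ is its opener and $b$ its closer. For $n=0$ there is exactly one (empty) matching. A matching is Stoimenow if it contains no pair of arcs $[i,\ell],[i+1,k]$ with $i+1<k<\ell$ (Type 1) and no pair of arcs $[k,j+1],[\ell,j]$ with $k<\ell<j$ (Type 2). A matching $M$ contains a pattern (a matching) $P$ with $m$ arcs if some $m$ arcs of $M$ become $P$ after their $2m$ endpoints are relabelled $1,\ldots,2m$ in the order-preserving way; otherwise $M$ avoids $P$. $\mathcal{M}_n(Q_1,\ldots,Q_r)$ denotes the set of Stoimenow matchings with $n$ arcs avoiding every one of $Q_1,\ldots,Q_r$. The patterns are $P_1=\{[1,3],[2,7],[4,5],[6,8]\}$ and $P_2=\{[1,3],[2,5],[4,7],[6,8]\}$. *)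

(* Defs.v *)
From mathcomp Require Import all_boot all_order all_algebra.

Set Implicit Arguments.
Unset Strict Implicit.
Unset Printing Implicit Defensive.

Import GRing.Theory.

(* The points 1, ..., 2n are the elements of 'I_n.*2, shifted by one: the     *)
(* ordinal of value i stands for the point i + 1.                             *)
Notation diagram n := {set {set 'I_n.*2}}.

Section Matchings.

Variable n : nat.
Implicit Types (M A : diagram n) (i j k l : 'I_n.*2).

Definition is_matching M : bool :=
  partition M [set: 'I_n.*2] && [forall B in M, #|B| == 2].

Definition is_arc M i j : bool := (i < j) && ([set i; j] \in M).

Definition has_type1 M : bool :=
  [exists i : 'I_n.*2, exists i' : 'I_n.*2,
   exists k : 'I_n.*2, exists l : 'I_n.*2,
    [&& i' == i.+1 :> nat, i' < k, k < l, is_arc M i l & is_arc M i' k]].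

Definition has_type2 M : bool :=
  [exists k : 'I_n.*2, exists l : 'I_n.*2,
   exists j : 'I_n.*2, exists j' : 'I_n.*2,
    [&& j' == j.+1 :> nat, k < l, l < j, is_arc M k j' & is_arc M l j]].

Definition stoimenow M : bool :=
  [&& is_matching M, ~~ has_type1 M & ~~ has_type2 M].

(* When #|cover A| = 2m, x |-> rank A x is the order-preserving bijection     *)
(* from the endpoints of the arcs of A onto {0, ..., 2m - 1}.                 *)
Definition rank A (x : 'I_n.*2) : nat := #|[set y in cover A | y < x]|.

Definition relabel m A : diagram m :=
  [set [set j : 'I_m.*2 | [exists x in B, rank A x == j]] |
    B : {set 'I_n.*2} in A].

Definition contains m M (P : diagram m) : bool :=
  [exists A : diagram n, [&& A \subset M, #|A| == m & relabel m A == P]].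

Definition avoids m M (P : diagram m) : bool := ~~ contains M P.

End Matchings.

(* Here a and b are the labels of the points, counted from 1.                 *)
Definition arc m (a b : nat) : {set 'I_m.*2} :=
  [set i : 'I_m.*2 | (i.+1 == a) || (i.+1 == b)].

Definition P1 : diagram 4 := [set arc 4 1 3; arc 4 2 7; arc 4 4 5; arc 4 6 8].
Definition P2 : diagram 4 := [set arc 4 1 3; arc 4 2 5; arc 4 4 7; arc 4 6 8].

Definition stoimenow_avoiding n m1 m2 (Q1 : diagram m1) (Q2 : diagram m2) :
    {set diagram n} :=
  [set M : diagram n | [&& stoimenow M, avoids M Q1 & avoids M Q2]].

Local Open Scope ring_scope.

(* A formal power series is its sequence of coefficients; equality of series  *)
(* is =1.                                                                     *)
Definition fps (R : Type) : Type := nat -> R.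

Section PowerSeries.

Variable R : comUnitRingType.
Implicit Types (f g h : fps R).

Definition fps_of_poly (p : {poly R}) : fps R := fun n => p`_n.

Definition fps_mul f g : fps R := fun n => \sum_(k < n.+1) f (n - k)%N * g k.

(* First n coefficients of 1 / f: the coefficient h n is obtained by solving  *)
(* \sum_(k <= n) f (n - k) * h k = (n == 0).                                  *)
Fixpoint fps_inv_coefs f (n : nat) : seq R :=
  if n is n'.+1 then
    let s := fps_inv_coefs f n' in
    rcons s (((n' == 0%N)%:R - \sum_(k < n') f (n' - k)%N * s`_k) / f 0%N)
  else [::].

Definition fps_inv f : fps R := fun n => (fps_inv_coefs f n.+1)`_n.

Definition fps_div g f : fps R := fps_mul g (fps_inv f).

Lemma size_fps_inv_coefs f n : size (fps_inv_coefs f n) = n.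
Proof. by elim: n => //= n IHn; rewrite size_rcons IHn. Qed.

Lemma nth_fps_inv_coefs f n k :
  (k < n)%N -> (fps_inv_coefs f n)`_k = fps_inv f k.
Proof.
elim: n => // n IHn; rewrite ltnS leq_eqVlt => /predU1P[-> //|lt_kn].
by rewrite /= nth_rcons size_fps_inv_coefs lt_kn IHn.
Qed.

Lemma fps_invE f n :
  fps_inv f n =
    ((n == 0%N)%:R - \sum_(k < n) f (n - k)%N * fps_inv f k) / f 0%N.
Proof.
rewrite {1}/fps_inv /= nth_rcons size_fps_inv_coefs ltnn eqxx.
by congr ((_ - _) / _); apply: eq_bigr => k _; rewrite nth_fps_inv_coefs.
Qed.

Lemma fps_mulV f :
  f 0%N \is a GRing.unit -> fps_mul f (fps_inv f) =1 fps_of_poly 1.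
Proof.
move=> Uf0 n; rewrite /fps_mul /fps_of_poly coef1 big_ord_recr /= subnn.
by rewrite [in X in _ + X]fps_invE mulrC divrK // addrC subrK.
Qed.

Lemma fps_mulC f g : fps_mul f g =1 fps_mul g f.
Proof.
move=> n; rewrite /fps_mul (reindex_inj rev_ord_inj) /=.
apply: eq_bigr => k _; rewrite subSS mulrC.
by rewrite subKn // -ltnS.
Qed.

Definition fps_trunc n f : {poly R} := \poly_(i < n.+1) f i.

Lemma coef_fps_mul n m f g : (m <= n)%N ->
  (fps_trunc n f * fps_trunc n g)`_m = fps_mul f g m.
Proof.
move=> le_mn; rewrite coefMr; apply: eq_bigr => k _.
have le_km : (k <= m)%N by rewrite -ltnS.
by rewrite !coef_poly !ltnS !(leq_trans _ le_mn) // leq_subr.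
Qed.

Lemma fps_mulA f g h : fps_mul f (fps_mul g h) =1 fps_mul (fps_mul f g) h.
Proof.
move=> n.
have trunc u v k : (k <= n)%N ->
    (fps_trunc n u * fps_trunc n v)`_k = (fps_trunc n (fps_mul u v))`_k.
  by move=> le_kn; rewrite coef_fps_mul // coef_poly ltnS le_kn.
rewrite -!(@coef_fps_mul n n) //.
transitivity ((fps_trunc n f * (fps_trunc n g * fps_trunc n h))`_n).
  rewrite !coefM; apply: eq_bigr => k _; congr (_ * _).
  by rewrite -trunc ?leq_subr.
rewrite mulrA !coefM; apply: eq_bigr => k _; congr (_ * _).
by rewrite trunc // -ltnS.
Qed.

Lemma fps_mul1 f : fps_mul (fps_of_poly 1) f =1 f.
Proof.
move=> n; rewrite /fps_mul big_ord_recr /= subnn /fps_of_poly.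
rewrite big1 ?add0r ?coef1 ?mul1r // => k _.
by rewrite coef1 subn_eq0 leqNgt ltn_ord mul0r.
Qed.

Lemma fps_mull f g h : g =1 h -> fps_mul f g =1 fps_mul f h.
Proof. by move=> gh n; apply: eq_bigr => k _; rewrite gh. Qed.

Lemma fps_divP f g h : f 0%N \is a GRing.unit ->
  h =1 fps_div g f <-> fps_mul f h =1 g.
Proof.
move=> Uf0; split=> [hE n | fhE n].
  rewrite (fps_mull f hE) /fps_div (fps_mull f (fps_mulC g _)) fps_mulA.
  by rewrite fps_mulC (fps_mull g (fps_mulV Uf0)) fps_mulC fps_mul1.
rewrite /fps_div fps_mulC -(fps_mull _ fhE) fps_mulA fps_mulC.
rewrite (fps_mull h (fps_mulC _ f)) (fps_mull h (fps_mulV Uf0)).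
by rewrite fps_mulC fps_mul1.
Qed.

End PowerSeries.

(* Main.v *)
Require Import Defs.
From mathcomp Require Import all_boot all_order all_algebra.
From mathcomp Require Import zify ring.

(** A Stoimenow matching that avoids [P1] is nonnesting.  If an arc [x, l]
encloses an arc [y, k], look leftwards from [y]: since two adjacent openers
may not start nested arcs, a closer must occur between [x] and [y] whose arc
begins before [x] ([nested_left]); symmetrically, an arc begins between [k]
and [l] and ends after [l] ([nested_right]).  These four arcs form [P1].
Conversely, both Stoimenow configurations and [P1] itself contain a nesting,
so the matchings to be counted are exactly the nonnesting matchings that
avoid [P2].

In a nonnesting matching the i-th opener is paired with the i-th closer, so
the matching is determined by its word of openers and closers, which is
recorded here by the sequence whose i-th entry is the number f i of closers
that precede the i-th opener. These sequences are the weakly increasing ones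
with f i <= i, and the arcs are recovered by explicit formulas: counting from
0, the i-th opener sits at i + f i, the j-th closer at j + #{i | f i <= j},
and the j-th closer precedes the i-th opener exactly when j < f i. Read
through this last equivalence, an occurrence of [P2] becomes a triple (j, k,
l) with f j < f k <= j < f l <= k ([diag_avoids_P2]).

The sequences without such a triple are counted by appending one entry at a
time.  Let v be the last entry and m the length.  If f v = v, every value
between v and m may be appended; otherwise only v and m may
([N_free_rcons]).  Let h be the number of sequences of length n, N the number
of those of the first kind, and W the sum of m - v - 1 over these.  Then, for
n > 0, passing from n to n + 1 gives h' = 2h + W, N' = N + h and W' = W + N.
Eliminating N and W leaves a linear recurrence for h whose coefficients are
those of 1 - 4x + 5x^2 - 3x^3, and the first four values give the numerator
(1 - x)^3. *)

Set Implicit Arguments.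
Unset Strict Implicit.
Unset Printing Implicit Defensive.

Import GRing.Theory.

(** * Occurrences of a pattern as increasing maps *)

Lemma card_ltn_ord N k : k <= N -> #|[set x : 'I_N | x < k]| = k.
Proof.
move=> kN; rewrite -sum1_card (eq_bigl (fun x : 'I_N => x < k)); last first.
  by move=> x; rewrite inE.
by rewrite (big_ord_narrow kN) sum1_card card_ord.
Qed.

(** The ranks of the endpoints of the chosen arcs are pairwise distinct numbers
below 2m, and there are 2m of them; so every label has exactly one preimage,
and inverting the rank gives the increasing map. *)
Lemma contains_incr m n (M : diagram n) (P : diagram m) :
  is_matching M -> contains M P ->
  exists2 g : 'I_m.*2 -> 'I_n.*2, {homo g : x y / x < y} &
    forall B, B \in P -> g @: B \in M.
Proof.
case/andP=> /and3P[_ triM _] /'forall_implyP card2.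
case/existsP=> A /and3P[sAM /eqP cardA /eqP <-].
have cardcA : #|cover A| = m.*2.
  rewrite -(eqP (trivIsetS sAM triM)); transitivity (\sum_(B in A) 2).
    by apply: eq_bigr => B /(subsetP sAM)/card2/eqP.
  by rewrite sum_nat_const cardA muln2.
have rank_lt (x y : 'I_n.*2) : x \in cover A -> x < y -> rank A x < rank A y.
  move=> xA xy; apply: proper_card; apply/properP; split.
    by apply/subsetP => z; rewrite !inE => /andP[-> /ltn_trans->].
  by exists x; rewrite !inE xA ?xy ?ltnn.
have rank_max x : x \in cover A -> rank A x < m.*2.
  move=> xA; rewrite -cardcA; apply: proper_card; apply/properP; split.
    by apply/subsetP => z; rewrite inE => /andP[].
  by exists x => //; rewrite inE ltnn andbF.
have rank_inj : {in cover A &, injective (rank A)}.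
  move=> x y xA yA e; apply: val_inj => /=.
  case: (ltngtP x y) => // xy; first by have := rank_lt _ _ xA xy; lia.
  by have := rank_lt _ _ yA xy; lia.
have [|||_ rank_onto] :=
  @uniq_min_size _ (map (rank A) (enum (cover A))) (iota 0 m.*2).
- rewrite map_inj_in_uniq ?enum_uniq // => x y; rewrite !mem_enum.
  exact: rank_inj.
- move=> _ /mapP[x xA ->]; rewrite mem_enum in xA.
  by rewrite mem_iota rank_max.
- by rewrite size_map size_iota -cardE cardcA.
have /fin_all_exists[g gP] (j : 'I_m.*2) :
    exists x, x \in cover A /\ rank A x = j.
  have: val j \in iota 0 m.*2 by rewrite mem_iota ltn_ord.
  rewrite -rank_onto => /mapP[x]; rewrite mem_enum => xA jE.
  by exists x.
exists g => [i j ij | _ /imsetP[B BA ->]].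
  have [[gi ri] [gj rj]] := (gP i, gP j); rewrite ltnNge; apply/negP.
  rewrite leq_eqVlt => /predU1P[/val_inj e|/(rank_lt _ _ gj)]; last by lia.
  by move: ij; rewrite -ri -rj e ltnn.
suff -> : g @: [set j : 'I_m.*2 | [exists x in B, rank A x == j]] = B.
  exact: (subsetP sAM).
have sBA x : x \in B -> x \in cover A by move=> xB; apply/bigcupP; exists B.
apply/setP => x; apply/imsetP/idP => [[j jB ->]|xB].
  move: jB; rewrite inE => /exists_inP[y yB /eqP ry].
  have [gj rj] := gP j.
  by rewrite (rank_inj (g j) y) // ?sBA // rj.
have xA := sBA x xB; exists (Ordinal (rank_max x xA)).
  by rewrite inE; apply/exists_inP; exists x.
by have [gj rj] := gP (Ordinal (rank_max x xA)); apply: rank_inj.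
Qed.

(** The rank of [g x] among the points of the image of [g] is [x], whence
relabelling undoes [g]; that [P] covers all points makes the endpoints of the
chosen arcs equal to the whole image of [g]. *)
Lemma incr_contains m n (M : diagram n) (P : diagram m)
    (g : 'I_m.*2 -> 'I_n.*2) :
  cover P = setT -> #|P| = m -> {homo g : x y / x < y} ->
  (forall B, B \in P -> g @: B \in M) -> contains M P.
Proof.
move=> coverP cardP g_homo gP.
have g_mono : {mono g : x y / x < y}.
  move=> x y; have [xy|yx|/val_inj->] := ltngtP x y; rewrite ?ltnn //.
    exact: g_homo.
  by apply/negbTE; rewrite -leqNgt ltnW // g_homo.
have g_inj : injective g.
  move=> x y e; apply: val_inj => /=.
  by have := (g_mono x y, g_mono y x); rewrite e ltnn => -[]; case: ltngtP.
apply/existsP; exists [set g @: (B : {set _}) | B in P]; apply/and3P; split.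
- by apply/subsetP => _ /imsetP[B BP ->]; apply: gP.
- by rewrite card_imset ?cardP //; apply: imset_inj.
set A := imset _ _.
have coverA : cover A = g @: setT.
  apply/setP => y; apply/bigcupP/imsetP.
    by move=> [_ /imsetP[B BP ->] /imsetP[x _ ->]]; exists x.
  case=> x _ ->; have: x \in cover P by rewrite coverP.
  case/bigcupP => B BP xB; exists (g @: B); rewrite ?imset_f //.
have rankE x : rank A (g x) = x.
  rewrite /rank coverA -[RHS](card_ltn_ord (ltnW (ltn_ord x))).
  rewrite -[RHS](card_imset _ g_inj); apply: eq_card => y.
  rewrite !inE; apply/andP/imsetP => [[/imsetP[z _ ->] gz]|[z + ->]].
    by exists z; rewrite ?inE // -g_mono.
  by rewrite inE -g_mono => zx; rewrite imset_f.
rewrite /relabel -imset_comp -[X in _ == X]imset_id; apply/eqP/eq_imset => B /=.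
apply/setP => j; rewrite inE; apply/exists_inP/idP => [[_ /imsetP[i iB ->]]|jB].
  by rewrite rankE => /eqP/val_inj<-.
by exists (g j); rewrite ?imset_f ?rankE.
Qed.

(** * The patterns P1 and P2 *)

Lemma imset_arc m n (g : 'I_m.*2 -> 'I_n.*2) (x y : 'I_m.*2) :
  g @: Defs.arc m x.+1 y.+1 = [set g x; g y].
Proof.
have -> : Defs.arc m x.+1 y.+1 = [set x; y].
  by apply/setP => z; rewrite !inE !eqSS.
by rewrite imsetU !imset_set1.
Qed.

Lemma arc_neq m a b c d :
  a < m.*2 -> a.+1 != c -> a.+1 != d ->
  (Defs.arc m a.+1 b == Defs.arc m c d) = false.
Proof.
move=> am /negPf ac /negPf ad; apply/negP => /eqP/setP/(_ (Ordinal am)).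
by rewrite !inE /= eqxx ac ad.
Qed.

Lemma cover_P1 : cover P1 = setT.
Proof.
apply/setP => -[i im]; rewrite in_setT; apply/bigcupP.
case: i im => [|[|[|[|[|[|[|[|//]]]]]]]] im.
- by exists (Defs.arc 4 1 3); rewrite !inE ?eqxx ?orbT.
- by exists (Defs.arc 4 2 7); rewrite !inE ?eqxx ?orbT.
- by exists (Defs.arc 4 1 3); rewrite !inE ?eqxx ?orbT.
- by exists (Defs.arc 4 4 5); rewrite !inE ?eqxx ?orbT.
- by exists (Defs.arc 4 4 5); rewrite !inE ?eqxx ?orbT.
- by exists (Defs.arc 4 6 8); rewrite !inE ?eqxx ?orbT.
- by exists (Defs.arc 4 2 7); rewrite !inE ?eqxx ?orbT.
- by exists (Defs.arc 4 6 8); rewrite !inE ?eqxx ?orbT.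
Qed.

Lemma cover_P2 : cover P2 = setT.
Proof.
apply/setP => -[i im]; rewrite in_setT; apply/bigcupP.
case: i im => [|[|[|[|[|[|[|[|//]]]]]]]] im.
- by exists (Defs.arc 4 1 3); rewrite !inE ?eqxx ?orbT.
- by exists (Defs.arc 4 2 5); rewrite !inE ?eqxx ?orbT.
- by exists (Defs.arc 4 1 3); rewrite !inE ?eqxx ?orbT.
- by exists (Defs.arc 4 4 7); rewrite !inE ?eqxx ?orbT.
- by exists (Defs.arc 4 2 5); rewrite !inE ?eqxx ?orbT.
- by exists (Defs.arc 4 6 8); rewrite !inE ?eqxx ?orbT.
- by exists (Defs.arc 4 4 7); rewrite !inE ?eqxx ?orbT.
- by exists (Defs.arc 4 6 8); rewrite !inE ?eqxx ?orbT.
Qed.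

Lemma card_P1 : #|P1| = 4.
Proof. by rewrite /P1 -!setUA !cardsU1 cards1 !inE !arc_neq. Qed.

Lemma card_P2 : #|P2| = 4.
Proof. by rewrite /P2 -!setUA !cardsU1 cards1 !inE !arc_neq. Qed.

Definition point8 (k : nat) (lt_k8 : k < 8) : 'I_4.*2 := Ordinal lt_k8.

Lemma contains_P1 n (M : diagram n) (x0 x1 x2 x3 x4 x5 x6 x7 : 'I_n.*2) :
  sorted ltn (map val [:: x0; x1; x2; x3; x4; x5; x6; x7]) ->
  [set x0; x2] \in M -> [set x1; x6] \in M ->
  [set x3; x4] \in M -> [set x5; x7] \in M -> contains M P1.
Proof.
set s := [:: _; _; _; _; _; _; _; _] => s_sorted M02 M16 M34 M57.
apply: (@incr_contains _ _ _ _ (fun i => nth x0 s i)).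
- exact: cover_P1.
- exact: card_P1.
- move=> i j ij /=; rewrite -!(nth_map _ 0 val) //.
  by apply: (sorted_ltn_nth ltn_trans) => //; rewrite inE.
move=> B; rewrite !inE -!orbA => /or4P[] /eqP->.
- by rewrite (imset_arc _ (@point8 0 isT) (@point8 2 isT)).
- by rewrite (imset_arc _ (@point8 1 isT) (@point8 6 isT)).
- by rewrite (imset_arc _ (@point8 3 isT) (@point8 4 isT)).
- by rewrite (imset_arc _ (@point8 5 isT) (@point8 7 isT)).
Qed.

Lemma contains_P2 n (M : diagram n) (x0 x1 x2 x3 x4 x5 x6 x7 : 'I_n.*2) :
  sorted ltn (map val [:: x0; x1; x2; x3; x4; x5; x6; x7]) ->
  [set x0; x2] \in M -> [set x1; x4] \in M ->
  [set x3; x6] \in M -> [set x5; x7] \in M -> contains M P2.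
Proof.
set s := [:: _; _; _; _; _; _; _; _] => s_sorted M02 M14 M36 M57.
apply: (@incr_contains _ _ _ _ (fun i => nth x0 s i)).
- exact: cover_P2.
- exact: card_P2.
- move=> i j ij /=; rewrite -!(nth_map _ 0 val) //.
  by apply: (sorted_ltn_nth ltn_trans) => //; rewrite inE.
move=> B; rewrite !inE -!orbA => /or4P[] /eqP->.
- by rewrite (imset_arc _ (@point8 0 isT) (@point8 2 isT)).
- by rewrite (imset_arc _ (@point8 1 isT) (@point8 4 isT)).
- by rewrite (imset_arc _ (@point8 3 isT) (@point8 6 isT)).
- by rewrite (imset_arc _ (@point8 5 isT) (@point8 7 isT)).
Qed.

Lemma contains_P1_nesting n (M : diagram n) : is_matching M -> contains M P1 ->
  exists i j k l : 'I_n.*2, [/\ i < j, k < l, is_arc M i l & is_arc M j k].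
Proof.
move=> mM /(contains_incr mM)[g g_homo gP].
have gM (x y : 'I_4.*2) :
    Defs.arc 4 x.+1 y.+1 \in P1 -> x < y -> is_arc M (g x) (g y).
  by move=> /gP; rewrite imset_arc /is_arc => -> xy; rewrite g_homo.
exists (g (@point8 1 isT)), (g (@point8 3 isT)).
exists (g (@point8 4 isT)), (g (@point8 6 isT)).
by rewrite !g_homo // !gM // !inE eqxx ?orbT.
Qed.

Lemma contains_P2_arcs n (M : diagram n) : is_matching M -> contains M P2 ->
  exists x0 x1 x2 x3 x4 x5 x6 x7 : 'I_n.*2,
   [/\ [/\ is_arc M x0 x2, is_arc M x1 x4, is_arc M x3 x6 & is_arc M x5 x7],
     x1 < x2, x2 < x3, x3 < x4 & x4 < x5 /\ x5 < x6].
Proof.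
move=> mM /(contains_incr mM)[g g_homo gP].
have gM (x y : 'I_4.*2) :
    Defs.arc 4 x.+1 y.+1 \in P2 -> x < y -> is_arc M (g x) (g y).
  by move=> /gP; rewrite imset_arc /is_arc => -> xy; rewrite g_homo.
exists (g (@point8 0 isT)), (g (@point8 1 isT)).
exists (g (@point8 2 isT)), (g (@point8 3 isT)).
exists (g (@point8 4 isT)), (g (@point8 5 isT)).
exists (g (@point8 6 isT)), (g (@point8 7 isT)).
by rewrite !g_homo // !gM // !inE eqxx ?orbT.
Qed.

(** * Nestings in Stoimenow matchings *)

Section Partner.
Variables (n : nat) (M : diagram n).
Hypothesis mM : is_matching M.
Implicit Types x y z : 'I_n.*2.

Lemma matching_card2 B : B \in M -> #|B| = 2.
Proof. by case/andP: mM => _ /'forall_implyP card2 /card2/eqP. Qed.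

Lemma arc_neq_ends x y : [set x; y] \in M -> y != x.
Proof. by move/matching_card2; rewrite cards2 eq_sym; case: eqP. Qed.

Definition partner x := odflt x [pick y | [set x; y] \in M].

Lemma partner_arc x : [set x; partner x] \in M.
Proof.
rewrite /partner; case: pickP => //= no_y.
case/andP: (mM) => /and3P[/eqP coverM triM _] _.
have xM : x \in cover M by rewrite coverM inE.
have BM := pblock_mem xM; have := matching_card2 BM.
move/eqP/cards2P => [a [b [_ Bab]]].
have : x \in pblock M x by rewrite mem_pblock.
rewrite Bab in BM *; rewrite !inE => /orP[]/eqP e.
  by have := no_y b; rewrite e BM.
by have := no_y a; rewrite e setUC BM.
Qed.

Lemma arc_partner x y : [set x; y] \in M -> partner x = y.
Proof.
move=> xyM; have xpM := partner_arc x.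
case/andP: (mM) => /and3P[_ triM _] _.
have := def_pblock triM xyM (set21 x y).
rewrite (def_pblock triM xpM (set21 x _)) => /setP/(_ (partner x)).
by rewrite !inE eqxx orbT (negPf (arc_neq_ends xpM)) => /esym/eqP.
Qed.

Lemma partnerK : involutive partner.
Proof. by move=> x; apply: arc_partner; rewrite setUC partner_arc. Qed.

Lemma partner_neq x : partner x != x :> nat.
Proof. by apply: contra_neq (arc_neq_ends (partner_arc x)) => /val_inj. Qed.

Lemma partner_inj x y : partner x = partner y :> nat -> x = y.
Proof. by move/val_inj/(can_inj partnerK). Qed.

Lemma is_arcE x y : is_arc M x y = (x < y) && (y == partner x).
Proof.
rewrite /is_arc; congr (_ && _); apply/idP/eqP => [/arc_partner-> //|->].
exact: partner_arc.
Qed.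

Lemma is_arc_partner x : x < partner x -> is_arc M x (partner x).
Proof. by rewrite is_arcE eqxx andbT. Qed.

End Partner.

Definition nonnesting n (M : diagram n) : Prop := forall i j k l : 'I_n.*2,
  i < j -> k < l -> is_arc M i l -> is_arc M j k -> False.

Section Nesting.
Variables (n : nat) (M : diagram n).
Hypothesis mM : is_matching M.
Implicit Types x y z : 'I_n.*2.
Local Notation p := (partner M).

(** Induction on [y].  Let z = y - 1.  It is not [x], and not an opener whose
arc encloses that of [y], since these would be of Type 1.  If z is an opener
nested in the arc of [x], or a closer whose opener lies after [x], the
induction hypothesis applies to that nested arc, which begins earlier than
[y]; otherwise z is the wanted closer. *)
Lemma nested_left x y : ~~ has_type1 M -> x < y -> y < p y -> p y < p x ->
  exists b : 'I_n.*2, [/\ x < b, b < y & p b < x].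
Proof.
move=> type1; have [k] := ubnP (nat_of_ord y).
elim: k y => // k IHk y yk xy yp px.
have zlt : y.-1 < n.*2 by have := ltn_ord y; lia.
pose z := Ordinal zlt; have zE : z = y.-1 :> nat by [].
have no1 (a b : 'I_n.*2) : b = a.+1 :> nat -> b < p b -> p b < p a -> False.
  move=> ab bp pa; case/negP: type1.
  apply/existsP; exists a; apply/existsP; exists b; apply/existsP; exists (p b).
  apply/existsP; exists (p a).
  by rewrite -ab eqxx bp pa !is_arc_partner //; lia.
have [zx|xz] : z = x :> nat \/ x < z by lia.
  by case: (no1 x y) => //; lia.
have := partner_neq mM z; case: ltngtP => // [pz|zp] _.
  have [pzx|xpz|/val_inj e] := ltngtP (p z) x.
  - by exists z; split=> //; lia.
  - have [||||b [xb bpz pbx]] := IHk (p z); rewrite ?partnerK //; try lia.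
    by exists b; split=> //; lia.
  - by move: px; rewrite -e partnerK //; lia.
have [pzx|xpz|/(partner_inj mM) e] := ltngtP (p z) (p x).
- have [||||b [xb bz pbx]] := IHk z; try lia.
  by exists b; split=> //; lia.
- by case: (no1 z y) => //; lia.
- by move: xz; rewrite e ltnn.
Qed.

(** The mirror image of [nested_left], with the point following [p y] in the
role of the point preceding [y] and Type 2 in the role of Type 1. *)
Lemma nested_right x y : ~~ has_type2 M -> x < y -> y < p y -> p y < p x ->
  exists c : 'I_n.*2, [/\ p y < c, c < p x & p x < p c].
Proof.
move=> type2; have [k] := ubnP (n.*2 - p y).
elim: k y => // k IHk y yk xy yp px.
have zlt : (p y).+1 < n.*2 by have := ltn_ord (p x); lia.
pose z := Ordinal zlt; have zE : z = (p y).+1 :> nat by [].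
have no2 (a b : 'I_n.*2) : p a = (p b).+1 :> nat -> a < b -> b < p b -> False.
  move=> pab ab bp; case/negP: type2.
  apply/existsP; exists a; apply/existsP; exists b; apply/existsP; exists (p b).
  apply/existsP; exists (p a).
  by rewrite -pab eqxx ab bp !is_arc_partner //; lia.
have [zx|zx] : z = p x :> nat \/ z < p x by lia.
  by case: (no2 x y) => //; lia.
have := partner_neq mM z; case: ltngtP => // [pz|zp] _.
  have [pzx|xpz|/val_inj e] := ltngtP (p z) x.
  - by case: (no2 (p z) y) => //; rewrite ?partnerK //; lia.
  - have [||||c [xc cpz pcx]] := IHk (p z); rewrite ?partnerK //; try lia.
    by rewrite partnerK // in xc; exists c; split=> //; lia.
  - by move: zx; rewrite -e partnerK // ltnn.
have [pzx|xpz|/(partner_inj mM) e] := ltngtP (p z) (p x).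
- have [||||c [xc cz pcx]] := IHk z; try lia.
  by exists c; split=> //; lia.
- by exists z; split=> //; lia.
- by have := congr1 (@nat_of_ord _) e; lia.
Qed.

Lemma stoimenow_avoid_P1 :
  ~~ has_type1 M -> ~~ has_type2 M -> avoids M P1 -> nonnesting M.
Proof.
move=> type1 type2 avoidsP1 x y py px xy pypx.
rewrite !(is_arcE mM) => /andP[_ /eqP pxE] /andP[ypy /eqP pyE].
rewrite {}pyE {}pxE in ypy pypx.
have [b [xb ltby pbx]] := nested_left type1 xy ypy pypx.
have [c [yc ltcx xpc]] := nested_right type2 xy ypy pypx.
case/negP: avoidsP1.
apply: (@contains_P1 _ _ (p b) x b y (p y) c (p x) (p c)) => /=.
- by rewrite pbx xb ltby ypy yc ltcx xpc.
- by rewrite setUC partner_arc.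
- exact: partner_arc.
- exact: partner_arc.
- exact: partner_arc.
Qed.

End Nesting.

(** * Ballot sequences *)

(** The sequences f of the closer counts f i of nonnesting matchings. *)
Definition ballot (s : seq nat) : Prop :=
  sorted leq s /\ forall i, i < size s -> nth 0 s i <= i.

(** The avoidance of [P2], expressed on closer counts.  Entries beyond the end
of [s] read as 0, but on a ballot sequence the inequalities force
j < k < l < size s. *)
Definition N_free (s : seq nat) : Prop := forall j k l,
  ~ [/\ nth 0 s j < nth 0 s k, nth 0 s k <= j,
        j < nth 0 s l & nth 0 s l <= k].

Lemma nth_gt0_size (s : seq nat) i a : a < nth 0 s i -> i < size s.
Proof. by case: (ltnP i (size s)) => // ?; rewrite nth_default. Qed.

Lemma ballot_mono s i j : ballot s -> i <= j -> j < size s ->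
  nth 0 s i <= nth 0 s j.
Proof.
move=> [ss _] ij jm.
by apply: (sorted_leq_nth leq_trans leqnn 0 ss) => //; rewrite inE; lia.
Qed.

Lemma ballot_ltn s i j : ballot s -> i < size s ->
  nth 0 s i < nth 0 s j -> i < j.
Proof.
move=> bs im lt_ij; rewrite ltnNge; apply/negP => le_ji.
by have := ballot_mono bs le_ji im; lia.
Qed.

(** * Closer counts of a nonnesting matching *)

Lemma count_ltn_iota t n : t <= n -> count (ltn^~ t) (iota 0 n) = t.
Proof.
move=> tn; rewrite -(subnKC tn) iotaD count_cat add0n.
rewrite (@eq_in_count _ _ xpredT) => [|i]; last by rewrite mem_iota => /andP[].
rewrite count_predT size_iota (@eq_in_count _ _ xpred0) ?count_pred0 ?addn0 //.
by move=> i; rewrite mem_iota => /andP[/leq_gtF].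
Qed.

Definition pts n (a b : nat) : {set 'I_n.*2} :=
  [set x : 'I_n.*2 | (x == a :> nat) || (x == b :> nat)].

(** The i-th opener is preceded by i openers and [nth 0 s i] closers. *)
Definition opener_pos (s : seq nat) i := i + nth 0 s i.
(** The j-th closer is preceded by j closers, and by the openers that have at
most j closers before them. *)
Definition closer_pos (s : seq nat) j := j + count (leq^~ j) s.

(** The nonnesting matching with closer counts [s]. *)
Definition diag n (s : seq nat) : diagram n :=
  [set pts n (opener_pos s i) (closer_pos s i) | i : 'I_n].

Lemma pts_ord n (x y : 'I_n.*2) : pts n x y = [set x; y].
Proof. by apply/setP => z; rewrite !inE. Qed.

Section Encode.
Variables (n : nat) (M : diagram n).
Hypothesis mM : is_matching M.
Implicit Types x y z : 'I_n.*2.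
Local Notation p := (partner M).

Definition openers_before (t : nat) :=
  #|[set y : 'I_n.*2 | (y < p y) && (y < t)]|.
Definition closers_before (t : nat) :=
  #|[set y : 'I_n.*2 | (p y < y) && (y < t)]|.

Lemma points_before t : t <= n.*2 -> openers_before t + closers_before t = t.
Proof.
move=> tn; rewrite -[RHS](card_ltn_ord tn).
rewrite -[RHS](cardsID [set y : 'I_n.*2 | y < p y]); congr (_ + _).
  by apply: eq_card => y; rewrite !inE andbC.
apply: eq_card => y; rewrite !inE -leqNgt [in RHS]leq_eqVlt.
by rewrite (negPf (partner_neq mM y)).
Qed.

Lemma openers_before_mono t u : t <= u -> openers_before t <= openers_before u.
Proof.
move=> tu; apply/subset_leq_card/subsetP => y; rewrite !inE => /andP[-> yt].
exact: leq_trans tu.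
Qed.

Lemma openers_before_lt x t : x < p x -> x < t ->
  openers_before x < openers_before t.
Proof.
move=> xp xt; apply: proper_card; apply/properP; split.
  apply/subsetP => y; rewrite !inE => /andP[-> yx]; exact: ltn_trans xt.
by exists x; rewrite !inE xp ?xt // ltnn.
Qed.

Lemma closers_before_lt x t : p x < x -> x < t ->
  closers_before x < closers_before t.
Proof.
move=> xp xt; apply: proper_card; apply/properP; split.
  apply/subsetP => y; rewrite !inE => /andP[-> yx]; exact: ltn_trans xt.
by exists x; rewrite !inE xp ?xt // ltnn.
Qed.

(** The openers of the closers up to position t lie before position t. *)
Lemma closers_before_le t : closers_before t.+1 <= openers_before t.
Proof.
rewrite /closers_before -(card_imset _ (can_inj (partnerK mM))).
apply/subset_leq_card/subsetP => _ /imsetP[y + ->].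
by rewrite !inE partnerK // => /andP[py yt]; rewrite py; lia.
Qed.

Lemma openers_half : openers_before n.*2 = n.
Proof.
suff e : closers_before n.*2 = openers_before n.*2.
  by have := points_before (leqnn _); lia.
rewrite /closers_before -(card_imset _ (can_inj (partnerK mM))).
apply: eq_card => y; apply/imsetP/idP => [[z + ->]|].
  by rewrite !inE partnerK // !ltn_ord !andbT.
rewrite inE => /andP[yp _]; exists (p y); rewrite ?partnerK //.
by rewrite inE partnerK // yp ltn_ord.
Qed.

Lemma openers_before_n x : x < p x -> openers_before x < n.
Proof. by move=> xp; rewrite -[X in _ < X]openers_half openers_before_lt. Qed.

(** The entry of index i is the number of closers before the i-th opener,
expressed without enumerating the openers: a closer z comes before the i-th
opener when at most i openers come before z. *)
Definition code : seq nat :=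
  mkseq
    (fun i => #|[set z : 'I_n.*2 | (p z < z) && (openers_before z <= i)]|) n.

(** For f i <= i, take the last closer [z] counted by f i: the closers up to
[z] have their openers before [z], and at most i openers come before [z]. *)
Lemma code_ballot : ballot code.
Proof.
split=> [|i]; rewrite ?size_mkseq.
  apply: homo_sorted (iota_sorted _ _) => i j ij.
  apply/subset_leq_card/subsetP => z; rewrite !inE => /andP[-> zi].
  exact: leq_trans ij.
move=> lt_in; rewrite nth_mkseq //; set S := finset _.
have [->|/set0Pn[z0 z0S]] := eqVneq S set0; first by rewrite cards0.
case: (@arg_maxnP _ z0 (mem S) (@nat_of_ord _) z0S) => z zS z_max.
have /andP[_ zi] : (p z < z) && (openers_before z <= i).
  by move: zS; rewrite /= inE.
apply: leq_trans zi; apply: leq_trans (closers_before_le z).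
apply/subset_leq_card/subsetP => y yS.
by have := z_max y yS; move: yS; rewrite !inE => /andP[-> _] /=; rewrite ltnS.
Qed.

Hypothesis nnM : nonnesting M.

(** As nothing nests, partnership is increasing on openers, so it matches the
openers before [x] with the closers before the partner of [x]. *)
Lemma closers_before_partner x : x < p x ->
  closers_before (p x) = openers_before x.
Proof.
move=> xp; rewrite /openers_before -(card_imset _ (can_inj (partnerK mM))).
have nn y z : y < z -> z < p z -> p z < p y -> False.
  move=> yz zp pzy; apply: (@nnM y z (p z) (p y)) => //.
    by rewrite is_arc_partner //; lia.
  by rewrite is_arc_partner.
apply: eq_card => z; rewrite inE; apply/andP/imsetP => [[pz zx]|[y + ->]].
  exists (p z); rewrite ?partnerK // inE partnerK // pz /=.
  have [//|xpz|/val_inj e] := ltngtP (p z) x; last first.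
    by move: zx; rewrite -e partnerK // ltnn.
  by case: (nn x (p z)); rewrite ?partnerK.
rewrite inE partnerK // => /andP[yp yx]; split=> //.
have [//|pxy|/(partner_inj mM) e] := ltngtP (p y) (p x).
  by case: (nn y x).
by move: yx; rewrite e ltnn.
Qed.

Lemma code_opener x : x < p x ->
  nth 0 code (openers_before x) = closers_before x.
Proof.
move=> xp; rewrite nth_mkseq ?openers_before_n //.
apply: eq_card => z; rewrite !inE; case: ltnP => //= pz.
have [zx|xz|/val_inj e] := ltngtP z x.
- exact/openers_before_mono/ltnW.
- by apply/negbTE; rewrite -ltnNge openers_before_lt.
- by move: pz; rewrite e; lia.
Qed.

Lemma code_closer x : x < p x ->
  count (leq^~ (openers_before x)) code = openers_before (p x).
Proof.
move=> xp; have kpx := closers_before_partner xp.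
rewrite count_map.
rewrite (@eq_in_count _ _ (ltn^~ (openers_before (p x)))) ?count_ltn_iota //.
  by rewrite -[X in _ <= X]openers_half openers_before_mono // ltnW.
move=> i _ /=; rewrite -kpx; have [lt_i|le_i] := ltnP.
  apply/subset_leq_card/subsetP => z; rewrite !inE => /andP[-> zi] /=.
  rewrite ltnNge; apply/negP => /openers_before_mono; lia.
apply/negbTE; rewrite -ltnNge.
apply: leq_trans (_ : closers_before (p x).+1 <= _).
  by apply: closers_before_lt => //; rewrite partnerK.
apply/subset_leq_card/subsetP => z; rewrite !inE => /andP[-> zi] /=.
by apply: leq_trans le_i; apply: openers_before_mono.
Qed.

(** Each arc of [M] is an arc of [diag n (code M)] by the two preceding
formulas, and the latter has at most n arcs. *)
Lemma diag_code : M = diag n code.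
Proof.
apply/eqP; rewrite eqEcard; apply/andP; split; last first.
  rewrite (leq_trans (leq_imset_card _ _)) // cardT size_enum_ord.
  case/andP: (mM) => partM _.
  have := card_uniform_partition (matching_card2 mM) partM.
  by rewrite cardsT card_ord; lia.
apply/subsetP => B BM; have := matching_card2 mM BM.
move/eqP/cards2P => [a [b [ab Bab]]].
have arcs x : x < p x -> [set x; p x] \in diag n code.
  move=> xp; apply/imsetP; exists (Ordinal (openers_before_n xp)) => //=.
  rewrite /opener_pos /closer_pos /= code_opener // code_closer //.
  rewrite -pts_ord; congr pts; first by rewrite points_before // ltnW.
  by rewrite -{1}(closers_before_partner xp) addnC points_before // ltnW.
rewrite Bab in BM *; rewrite -(arc_partner mM BM).
have := partner_neq mM a; case: ltngtP => // pa _; last exact: arcs.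
by rewrite setUC; have := arcs (p a); rewrite partnerK //; apply.
Qed.
End Encode.

(** * The nonnesting matching of a ballot sequence *)

Section Decode.
Variables (n : nat) (s : seq nat).
Hypotheses (sn : size s = n) (bs : ballot s).
Local Notation f := (nth 0 s).
Local Notation o := (opener_pos s).
Local Notation c := (closer_pos s).

Lemma nth_le_count i j : i < n -> (f i <= j) = (i < count (leq^~ j) s).
Proof.
move=> lt_in; rewrite -sn in lt_in.
have [lt|ge] := ltnP i.
  exact: (Order.POrderTheory.nth_count_le (x := j) 0 bs.1 lt).
apply/negbTE; rewrite -ltnNge.
apply: (Order.TotalTheory.DualTotalTheory.nth_count_gt (x := j) 0 bs.1).
by rewrite ge.
Qed.

Lemma opener_lt_closer i j : i < n -> (o i < c j) = (f i <= j).
Proof.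
move=> lt_in; rewrite /opener_pos /closer_pos.
by have := nth_le_count j lt_in; case: leqP; lia.
Qed.

Lemma closer_lt_opener i j : i < n -> (c j < o i) = (j < f i).
Proof.
move=> lt_in; rewrite /opener_pos /closer_pos.
by have := nth_le_count j lt_in; case: leqP; lia.
Qed.

Lemma opener_pos_ltn i j : i < n -> j < n -> (o i < o j) = (i < j).
Proof.
move=> lt_in lt_jn; rewrite /opener_pos.
have [ij|ji] := ltnP i j.
  by have := ballot_mono bs (ltnW ij); rewrite sn => /(_ lt_jn); lia.
by have := ballot_mono bs ji; rewrite sn => /(_ lt_in); lia.
Qed.

Lemma closer_pos_ltn i j : (c i < c j) = (i < j).
Proof.
have mono a b : a <= b -> count (leq^~ a) s <= count (leq^~ b) s.
  by move=> ab; apply: sub_count => x /= xa; apply: leq_trans ab.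
rewrite /closer_pos; have [ij|ji] := ltnP i j.
  by have := mono _ _ (ltnW ij); lia.
by have := mono _ _ ji; lia.
Qed.

Lemma arc_ends i : i < n -> o i < c i.
Proof. by move=> lt_in; rewrite opener_lt_closer // bs.2 ?sn. Qed.

Lemma closer_pos_max i : i < n -> c i < n.*2.
Proof.
by move=> lt_in; have := count_size (leq^~ i) s; rewrite /closer_pos; lia.
Qed.

Lemma arc_points i : i < n ->
  exists x y : 'I_n.*2, x = o i :> nat /\ y = c i :> nat.
Proof.
move=> lt_in; have ci := closer_pos_max lt_in.
by exists (Ordinal (ltn_trans (arc_ends lt_in) ci)), (Ordinal ci).
Qed.

Lemma mem_diag i (x y : 'I_n.*2) : i < n ->
  x = o i :> nat -> y = c i :> nat -> [set x; y] \in diag n s.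
Proof.
move=> lt_in xo yc; apply/imsetP; exists (Ordinal lt_in) => //=.
by rewrite -xo -yc pts_ord.
Qed.

Lemma opener_neq_closer i j : i < n -> o i != c j.
Proof.
move=> lt_in; rewrite neq_ltn opener_lt_closer // closer_lt_opener //.
exact: leqVgt.
Qed.

Lemma opener_pos_inj i j : i < n -> j < n -> o i = o j -> i = j.
Proof.
move=> lt_in lt_jn e; have := opener_pos_ltn lt_in lt_jn.
by have := opener_pos_ltn lt_jn lt_in; rewrite e ltnn; case: ltngtP.
Qed.

Lemma closer_pos_inj i j : c i = c j -> i = j.
Proof.
by move=> e; have := closer_pos_ltn i j; have := closer_pos_ltn j i;
  rewrite e ltnn; case: ltngtP.
Qed.

Lemma pts_meet i j (x : 'I_n.*2) : i < n -> j < n ->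
  x \in pts n (o i) (c i) -> x \in pts n (o j) (c j) -> i = j.
Proof.
move=> lt_in lt_jn; rewrite !inE => /orP[]/eqP-> /orP[] /eqP e.
- exact: opener_pos_inj.
- by have := opener_neq_closer j lt_in; rewrite e eqxx.
- by have := opener_neq_closer i lt_jn; rewrite e eqxx.
- exact: closer_pos_inj.
Qed.

Lemma card_pts i : i < n -> #|pts n (o i) (c i)| = 2.
Proof.
move=> lt_in; have [x [y [xo yc]]] := arc_points lt_in.
rewrite -xo -yc pts_ord cards2; case: eqP => // e.
by have := arc_ends lt_in; rewrite -xo -yc e ltnn.
Qed.

Lemma card_diag : #|diag n s| = n.
Proof.
rewrite card_imset ?card_ord // => i j e; apply: val_inj.
have [x [y [xo _]]] := arc_points (ltn_ord i).
by apply: (@pts_meet i j x) => //; rewrite -?e inE xo eqxx.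
Qed.

(** The n arcs are disjoint pairs among 2n points, so they cover every point. *)
Lemma matching_diag : is_matching (diag n s).
Proof.
have card2 B : B \in diag n s -> #|B| = 2.
  by case/imsetP => i _ ->; rewrite card_pts.
have tri : trivIset (diag n s).
  apply/trivIsetP => _ _ /imsetP[i _ ->] /imsetP[j _ ->].
  apply: contraR => /pred0Pn[x /andP[/= xi xj]].
  by rewrite (@pts_meet i j x).
apply/andP; split; last by apply/'forall_implyP => B /card2->.
apply/and3P; split=> //; last by apply/negP => /card2; rewrite cards0.
rewrite eqEcard subsetT cardsT card_ord -(eqP tri).
rewrite (eq_bigr (fun=> 2)); last by move=> B /card2.
by rewrite sum_nat_const card_diag muln2 leqnn.
Qed.

Lemma is_arc_diag x y : is_arc (diag n s) x y ->
  exists2 i, i < n & x = o i :> nat /\ y = c i :> nat.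
Proof.
case/andP => xy /imsetP[[i lt_in] _ /= e]; exists i => //.
have := arc_ends lt_in.
have : x \in [set x; y] by rewrite set21.
have : y \in [set x; y] by rewrite set22.
by rewrite e !inE => /orP[]/eqP yE /orP[]/eqP xE; lia.
Qed.

Lemma diag_nonnesting : nonnesting (diag n s).
Proof.
move=> i j k l ij kl /is_arc_diag[a an [ia la]] /is_arc_diag[b bn [jb kb]].
move: ij kl; rewrite ia jb kb la opener_pos_ltn // closer_pos_ltn; lia.
Qed.

(** Let i, j, k, l be the indices of the four arcs of an occurrence of [P2], by
increasing opener.  Its order conditions read
f j <= i < f k <= j < f l <= k, and an index i with the first two
inequalities exists if and only if f j < f k; f j itself is then one. *)
Lemma diag_avoids_P2 : avoids (diag n s) P2 <-> N_free s.
Proof.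
split=> [avoid j k l [jk kj jl lk]|Ns]; last first.
  apply/negP => /(contains_P2_arcs matching_diag).
  move=> [x0 [x1 [x2 [x3 [x4 [x5 [x6 [x7]]]]]]]] [[]].
  move=> /is_arc_diag[i im [_ ci]] /is_arc_diag[j jm [oj cj]].
  move=> /is_arc_diag[k km [ok ck]] /is_arc_diag[l lm [ol _]].
  rewrite ci cj ck oj ok ol !opener_lt_closer // !closer_lt_opener //.
  by move=> ji ik kj [jl lk]; apply: (Ns j k l); split=> //; lia.
have km : k < n by rewrite -sn; apply: nth_gt0_size jk.
have lm : l < n by rewrite -sn; apply: nth_gt0_size jl.
have jm : j < n by have := bs.2 l; rewrite sn => /(_ lm); lia.
have im : f j < n by lia.
have jk' : j < k by apply: (ballot_ltn bs); rewrite ?sn.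
have kl' : k < l by apply: (ballot_ltn bs); rewrite ?sn //; lia.
have [x0 [x2 [e0 e2]]] := arc_points im.
have [x1 [x4 [e1 e4]]] := arc_points jm.
have [x3 [x6 [e3 e6]]] := arc_points km.
have [x5 [x7 [e5 e7]]] := arc_points lm.
case/negP: avoid; apply: (@contains_P2 _ _ x0 x1 x2 x3 x4 x5 x6 x7);
  [|exact: mem_diag e0 e2|exact: mem_diag e1 e4|exact: mem_diag e3 e6
   |exact: mem_diag e5 e7].
rewrite /= e0 e1 e2 e3 e4 e5 e6 e7 opener_pos_ltn // closer_pos_ltn.
by rewrite !opener_lt_closer // !closer_lt_opener // andbT; lia.
Qed.

Lemma opener_diag (x : 'I_n.*2) :
  (exists y, is_arc (diag n s) x y) <-> exists2 i, i < n & x = o i :> nat.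
Proof.
split=> [[y /is_arc_diag[i lt_in [xo _]]]|[i lt_in xo]]; first by exists i.
have [_ [y [_ yc]]] := arc_points lt_in; exists y.
by rewrite /is_arc (mem_diag lt_in) // andbT xo yc arc_ends.
Qed.

End Decode.

(** The openers of [diag n s] form the range of the strictly increasing function
[opener_pos s], which is thereby determined. *)
Lemma diag_inj n s t : size s = n -> ballot s -> size t = n -> ballot t ->
  diag n s = diag n t -> s = t.
Proof.
move=> sn bs tn bt e.
have o_sorted u : size u = n -> ballot u -> sorted ltn (mkseq (opener_pos u) n).
  move=> un bu; apply/(sortedP 0) => i; rewrite size_mkseq => lt_in.
  have lt_i := ltnW lt_in.
  by rewrite /= !nth_mkseq // (opener_pos_ltn un bu lt_i lt_in).
have mem_o u : size u = n -> ballot u -> forall v,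
    v \in mkseq (opener_pos u) n <->
    exists2 x : 'I_n.*2, x = v :> nat & exists y, is_arc (diag n u) x y.
  move=> un bu v; split=> [/mapP[i]|[x <- /(opener_diag un bu)[i lt_in ->]]].
    rewrite mem_iota => lt_in ->; have [x [_ [xo _]]] := arc_points un bu lt_in.
    by exists x => //; apply/opener_diag => //; exists i.
  by apply: map_f; rewrite mem_iota.
have o_eq : mkseq (opener_pos s) n = mkseq (opener_pos t) n.
  apply: (irr_sorted_eq ltn_trans ltnn); rewrite ?o_sorted // => v.
  by apply/idP/idP => /mem_o h; apply/mem_o => //; move: h; rewrite e; apply.
apply: (@eq_from_nth _ 0) => [|i]; rewrite sn // => lt_in.
have /(congr1 (fun u => nth 0 u i)) := o_eq.
by rewrite !nth_mkseq // => /addnI.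
Qed.

(** * Enumeration of the ballot sequences avoiding the pattern *)

Lemma nth_le_last s i : ballot s -> nth 0 s i <= last 0 s.
Proof.
move=> bs; have [im|mi] := ltnP i (size s); last by rewrite nth_default.
by rewrite -nth_last; apply: ballot_mono => //; lia.
Qed.

Lemma last_le_size s : ballot s -> 0 < size s -> last 0 s < size s.
Proof.
by move=> [_ bs] s_gt0; rewrite -nth_last; have := bs (size s).-1; lia.
Qed.

(** For a nonempty [s] with last entry v, this says that the opener of index v
is the first one preceded by v closers: all arcs opened before it are closed,
and the openers from there on form a single run. *)
Definition fresh (s : seq nat) : bool := nth 0 s (last 0 s) == last 0 s.

(** The last entry is listed apart, so that for the empty sequence, where it
reads as 0 = size s, the value 0 is listed only once. *)
Definition next_values (s : seq nat) : seq nat :=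
  let v := last 0 s in
  v :: (if fresh s then iota v.+1 (size s - v) else [:: size s]).

Lemma mem_next_values s u : ballot s ->
  (u \in next_values s) =
    (last 0 s <= u <= size s) &&
    [|| u == last 0 s, u == size s | fresh s].
Proof.
move=> bs; rewrite /next_values inE.
have := @last_le_size s bs.
case: s {bs} => [|x s] /=; first by rewrite /fresh /= in_nil; lia.
by case: fresh; rewrite ?mem_iota ?inE /=; lia.
Qed.

Lemma ballot_rcons s u :
  ballot (rcons s u) <-> ballot s /\ last 0 s <= u <= size s.
Proof.
have -> : ballot (rcons s u) <->
    path leq 0 (rcons s u) /\
    forall i, i < (size s).+1 -> nth 0 (rcons s u) i <= i.
  by rewrite /ballot size_rcons; case: s => [|x s].
have -> : ballot s <-> path leq 0 s /\ forall i, i < size s -> nth 0 s i <= i.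
  by case: s.
rewrite rcons_path; split=> [[/andP[-> ->] le_i]|[[-> le_i] /andP[-> us]]].
  split; last by have := le_i _ (ltnSn _); rewrite nth_rcons ltnn eqxx.
  by split=> // i im; have := le_i i (ltnW im); rewrite nth_rcons im.
split=> // i; rewrite ltnS leq_eqVlt nth_rcons.
by case/predU1P=> [->|im]; rewrite ?ltnn ?eqxx // im le_i.
Qed.

Lemma nth_rcons_lt (s : seq nat) u i : i < size s ->
  nth 0 (rcons s u) i = nth 0 s i.
Proof. by move=> im; rewrite nth_rcons im. Qed.

Lemma nth_rcons_size (s : seq nat) u : nth 0 (rcons s u) (size s) = u.
Proof. by rewrite nth_rcons ltnn eqxx. Qed.

(** If v is the last entry, m the length, f v < v and v < u < m, then
(j, k, l) = (v, m - 1, m) is an occurrence of the pattern.  Conversely let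
(j, k, m) be an occurrence using the new entry u.  If u = v, or if
j < v, then (j, k, m - 1) is already an occurrence; u = m is impossible, as
u <= k < m; and if v <= j then f v <= f j < f k <= v, so f v = v fails. *)
Lemma N_free_rcons s u : ballot (rcons s u) ->
  N_free (rcons s u) <->
  N_free s /\ [|| u == last 0 s, u == size s | fresh s].
Proof.
move=> bsu; have [bs /andP[vu um]] := (ballot_rcons _ _).1 bsu.
split=> [Nsu | [Ns uP] j k l [jk kj jl lk]].
  split=> [j k l [jk kj jl lk]|].
    have km := nth_gt0_size jk; have lm := nth_gt0_size jl.
    have jm : j < size s by lia.
    by apply: (Nsu j k l); rewrite !nth_rcons_lt.
  apply/contraT; rewrite !negb_or /fresh => /and3P[u'v u'm bv].
  have vm : last 0 s < size s by lia.
  have := Nsu (last 0 s) (size s).-1 (size s); case.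
  rewrite nth_rcons_size !nth_rcons_lt ?nth_last //; last lia.
  by have := bs.2 _ vm; split; lia.
have := nth_gt0_size jl; rewrite size_rcons ltnS => lm.
have km' := nth_gt0_size jk; rewrite size_rcons in km'.
have j_lt_k : j < k by apply: (ballot_ltn bsu) => //; rewrite size_rcons; lia.
have k_lt_l : k < l by apply: (ballot_ltn bsu); rewrite ?size_rcons; lia.
have km : k < size s by lia.
have jm : j < size s by lia.
move: jk kj jl lk; rewrite (@nth_rcons_lt _ _ k) // (@nth_rcons_lt _ _ j) //.
move: lm; rewrite leq_eqVlt => /predU1P[->|lm]; last first.
  by rewrite nth_rcons_lt // => *; apply: (Ns j k l); split.
rewrite nth_rcons_size => jk kj ju uk.
have last_ok := @Ns j k (size s).-1; rewrite nth_last in last_ok.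
have := nth_le_last k bs.
case/or3P: uP => [/eqP uv|/eqP uE|/eqP fr]; [|lia|] => kv.
  by apply: last_ok; split; lia.
have vm : last 0 s < size s by lia.
have [v_le_j|j_lt_v] := leqP (last 0 s) j.
  by have := ballot_mono bs v_le_j jm; lia.
by apply: last_ok; split; lia.
Qed.

Lemma code_rcons s u :
  ballot (rcons s u) /\ N_free (rcons s u) <->
  [/\ ballot s, N_free s & u \in next_values s].
Proof.
split=> [[bsu Nsu]|[bs Ns]].
  have [bs us] := (ballot_rcons _ _).1 bsu.
  have [Ns uP] := (N_free_rcons bsu).1 Nsu.
  by split=> //; rewrite mem_next_values // us.
rewrite mem_next_values // => /andP[us uP].
have bsu : ballot (rcons s u) by apply/ballot_rcons.
by split=> //; apply/N_free_rcons.
Qed.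

Fixpoint codes n : seq (seq nat) :=
  if n is n'.+1 then [seq rcons s u | s <- codes n', u <- next_values s]
  else [:: [::]].

Arguments codes : simpl never.

Lemma codesS n :
  codes n.+1 = [seq rcons s u | s <- codes n, u <- next_values s].
Proof. by []. Qed.

Lemma mem_codes n (s : seq nat) :
  s \in codes n <-> [/\ size s = n, ballot s & N_free s].
Proof.
elim: n s => [|n IHn] s.
  rewrite inE; split=> [/eqP->|[/size0nil-> //]].
  by split=> // j k l; rewrite !nth_nil => -[].
rewrite codesS; split=> [/allpairsPdep[t [u [tn ut ->]]]|].
  have [<- bt Nt] := (IHn t).1 tn; rewrite size_rcons.
  by have [] := (code_rcons t u).2 (And3 bt Nt ut).
elim/last_ind: s => [|s u _] [] //; rewrite size_rcons => -[sn] bs Ns.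
have [bt Nt ut] := (code_rcons s u).1 (conj bs Ns).
by apply/allpairsPdep; exists s, u; split=> //; apply/IHn.
Qed.

Lemma codes_uniq n : uniq (codes n).
Proof.
elim: n => // n IHn; rewrite codesS; apply: allpairs_uniq_dep => //.
  move=> s /mem_codes[_ bs _].
  rewrite /next_values; case: ifP => fr /=.
    by rewrite iota_uniq mem_iota ltnn.
  rewrite inE andbT; apply: contraFneq fr => v_m.
  move: (@last_le_size s bs); rewrite -v_m; case: s bs v_m => //= x s _ ->.
  by rewrite ltnn => /(_ isT).
by move=> [s u] [t v] _ _ /= /rcons_inj[-> ->].
Qed.

Definition num_codes n := size (codes n).
Definition num_fresh n := count fresh (codes n).
(** The number of values strictly between the last entry and the length, summed
over the sequences that accept all of them. *)
Definition fresh_room n := \sum_(s <- codes n | fresh s) (n - (last 0 s).+1).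

Lemma last_lt_codes n (s : seq nat) : s \in codes n.+1 -> last 0 s < size s.
Proof. by move=> /mem_codes[sn bs _]; apply: last_le_size; rewrite ?sn. Qed.

Lemma sum_codesS n (F : seq nat -> nat) :
  \sum_(s <- codes n.+1) F s =
  \sum_(s <- codes n) \sum_(u <- next_values s) F (rcons s u).
Proof. by rewrite codesS big_allpairs_dep. Qed.

Lemma fresh_rcons s u : ballot s -> last 0 s < size s ->
  u \in next_values s ->
  fresh (rcons s u) = (u == size s) || fresh s && (u == last 0 s).
Proof.
move=> bs vm; rewrite mem_next_values // /fresh last_rcons => /andP[/andP[vu]].
rewrite leq_eqVlt => /predU1P[->|um] uP; first by rewrite nth_rcons_size !eqxx.
rewrite nth_rcons_lt // (ltn_eqF um) /=.
have [->|u'v] := eqVneq u (last 0 s); first by rewrite andbT.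
by rewrite andbF; apply/negP => /eqP e; have := nth_le_last u bs; lia.
Qed.

Lemma num_codesS n : num_codes n.+2 = 2 * num_codes n.+1 + fresh_room n.+1.
Proof.
rewrite /num_codes /fresh_room -!sum1_size sum_codesS big_distrr /=.
rewrite [X in _ + X]big_mkcond -big_split; apply: eq_big_seq => s sP.
have [sn _ _] := (mem_codes _ _).1 sP; have := last_lt_codes sP.
by rewrite sum1_size /next_values; case: fresh; rewrite /= ?size_iota; lia.
Qed.

Lemma num_freshS n : num_fresh n.+2 = num_fresh n.+1 + num_codes n.+1.
Proof.
rewrite /num_fresh /num_codes -!sum1_count -sum1_size big_mkcond.
rewrite (sum_codesS n.+1).
rewrite [X in X + _]big_mkcond -big_split; apply: eq_big_seq => s sP.
have [sn bs _] := (mem_codes _ _).1 sP; have vm := last_lt_codes sP.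
rewrite -big_mkcond /= sum1_count.
rewrite (@eq_in_count _ _
    (fun u => (u == size s) || fresh s && (u == last 0 s))); last first.
  by move=> u; apply: fresh_rcons.
rewrite /next_values; case: ifP => _ /=; last by rewrite (ltn_eqF vm) eqxx.
rewrite (ltn_eqF vm) eqxx /=; congr _.+1.
rewrite (@eq_in_count _ _ (pred1 (size s))) => [|u]; last first.
  by rewrite mem_iota /=; lia.
rewrite count_uniq_mem ?iota_uniq // mem_iota vm addSn ltnS subnKC ?leqnn //.
exact: ltnW.
Qed.

Lemma fresh_roomS n : fresh_room n.+2 = fresh_room n.+1 + num_fresh n.+1.
Proof.
rewrite /fresh_room /num_fresh -sum1_count big_mkcond (sum_codesS n.+1).
rewrite -big_split [RHS]big_mkcond; apply: eq_big_seq => s sP.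
have [sn bs _] := (mem_codes _ _).1 sP; have vm := last_lt_codes sP.
rewrite (eq_big_seq
    (fun u => if fresh s && (u == last 0 s) then n.+1 - u else 0)); last first.
  move=> u us; rewrite fresh_rcons // last_rcons subSS sn.
  by case: eqVneq => [->|_] //=; rewrite subnn; case: ifP.
rewrite /next_values; case: ifP => fr /=; last first.
  by rewrite big1.
rewrite big_cons eqxx big1_seq => [|u]; last first.
  by rewrite mem_iota /=; case: eqVneq => //; lia.
by lia.
Qed.

(** Elimination of [num_fresh] and [fresh_room] from the three recurrences. *)
Lemma num_codes_rec n :
  num_codes n.+4 + 5 * num_codes n.+2 = 4 * num_codes n.+3 + 3 * num_codes n.+1.
Proof.
have := num_freshS n; have := fresh_roomS n; have := fresh_roomS n.+1.
have := num_codesS n; have := num_codesS n.+1; have := num_codesS n.+2.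
by lia.
Qed.

(** * The matchings as coded by the enumerated sequences *)

Lemma stoimenow_avoidingE n :
  stoimenow_avoiding n P1 P2 =i [seq diag n s | s <- codes n].
Proof.
move=> M; rewrite inE; apply/and3P/mapP => [[]|[s /mem_codes[sn bs Ns] ->]].
  case/and3P => mM type1 type2 avoid1 avoid2.
  have nnM := stoimenow_avoid_P1 mM type1 type2 avoid1.
  have DM := diag_code mM nnM.
  exists (code M) => //; apply/mem_codes.
  have sn : size (code M) = n by apply: size_mkseq.
  have bs := code_ballot mM.
  by split=> //; apply/(diag_avoids_P2 sn bs); rewrite -DM.
have mM := matching_diag sn bs; have nnM := diag_nonnesting sn bs.
split.
- apply/and3P; split=> //.
    apply/negP => /existsP[i /existsP[j /existsP[k /existsP[l]]]].
    case/and5P => /eqP ij _ kl il jk; apply: (nnM i j k l) => //; lia.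
  apply/negP => /existsP[k /existsP[l /existsP[j /existsP[j']]]].
  case/and5P => /eqP ij kl _ kj lj; apply: (nnM k l j j') => //; lia.
- apply/negP => /(contains_P1_nesting mM)[i [j [k [l [ij kl il jk]]]]].
  exact: (nnM i j k l).
- exact/(diag_avoids_P2 sn bs).
Qed.

Lemma card_stoimenow_avoiding n : #|stoimenow_avoiding n P1 P2| = num_codes n.
Proof.
rewrite (eq_card (@stoimenow_avoidingE n)) /num_codes -(size_map (diag n)).
apply/card_uniqP; rewrite map_inj_in_uniq ?codes_uniq // => s t.
move=> /mem_codes[sn bs _] /mem_codes[tn bt _].
exact: diag_inj.
Qed.

(** * The generating function *)

Local Open Scope ring_scope.

Lemma fps_num_codes (R : comUnitRingType) :
  (fun n => (num_codes n)%:R : R) =1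
  fps_div (fps_of_poly ((1 - 'X) ^+ 3))
          (fps_of_poly (1 - 4%:R *: 'X + 5%:R *: 'X^2 - 3%:R *: 'X^3)).
Proof.
set num := (1 - 'X) ^+ 3; set den := 1 - _ *: 'X + _ - _.
have denE i : den`_i = nth 0 [:: 1; - 4%:R; 5%:R; - 3%:R] i.
  rewrite /den !(coefD, coefN, coefZ, coefX, coefXn, coef1).
  case: i => [|[|[|[|i]]]] /=; rewrite ?nth_nil; ring.
have numE i : num`_i = nth 0 [:: 1; - 3%:R; 3%:R; - 1] i.
  have -> : num = 1 - 3%:R *: 'X + 3%:R *: 'X^2 - 'X^3.
    by rewrite /num !scaler_nat; ring.
  rewrite !(coefD, coefN, coefZ, coefX, coefXn, coef1).
  by case: i => [|[|[|[|i]]]] /=; rewrite ?nth_nil; ring.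
apply/fps_divP => [|n]; first by rewrite /fps_of_poly denE unitr1.
rewrite /fps_mul /fps_of_poly numE.
under eq_bigr do rewrite denE.
have initE := (erefl : num_codes 0 = 1%N, erefl : num_codes 1 = 1%N,
               erefl : num_codes 2 = 2%N, erefl : num_codes 3 = 5%N).
case: n => [|[|[|[|n]]]].
- by rewrite !big_ord_recr big_ord0 /= !initE; ring.
- by rewrite !big_ord_recr big_ord0 /= !initE; ring.
- by rewrite !big_ord_recr big_ord0 /= !initE; ring.
- by rewrite !big_ord_recr big_ord0 /= !initE; ring.
have [e4 e3 e2 e1] : [/\ n.+4 - n = 4, n.+4 - n.+1 = 3, n.+4 - n.+2 = 2
    & n.+4 - n.+3 = 1]%N by split; lia.
rewrite !big_ord_recr big1 => [|k _] /=; last first.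
  by rewrite nth_default /=; [ring|have := ltn_ord k; lia].
rewrite subnn e4 e3 e2 e1 /= nth_nil.
have eqS : (num_codes n.+4)%:R + 5%:R * (num_codes n.+2)%:R
         = 4%:R * (num_codes n.+3)%:R + 3%:R * (num_codes n.+1)%:R :> R.
  by rewrite -!natrM -!natrD num_codes_rec.
move/eqP: eqS; rewrite -subr_eq0 => /eqP {}eqS.
by rewrite -[RHS]eqS; ring.
Qed.

Theorem theorem3p1 :
  (fun n : nat => #|stoimenow_avoiding n P1 P2|%:R : rat) =1
  fps_div (fps_of_poly ((1 - 'X) ^+ 3))
          (fps_of_poly (1 - 4%:R *: 'X + 5%:R *: 'X^2 - 3%:R *: 'X^3)).
Proof. by move=> n; rewrite /= card_stoimenow_avoiding fps_num_codes. Qed.
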